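(* Work in either the function setting or the operator setting. Let $\tilde H\in\mathbb{R}^{\mathcal I_N\times\mathcal I_N}$ be strictly lower triangular and $\tau>0$. Consider one of the performance setups (D,D), (D,G), (G,D), (G,G), where $q\ge0$ for (D,G) and $q>0$ for the other three. Suppose that $\Lambda$ is an invertible reduced PEP certificate for $\tilde H$ with rate $\tau$ and this performance setup, and that $\Lambda$ is tridiagonal (that is, $\Lambda_{ij}=0$ whenever $|i-j|>1$). Let $\Phi=(P\Lambda P)^{-1}$ for the setup (D,G), and $\Phi=(\bar P\Lambda\bar P)^{-1}$ for the setups (D,D), (G,D), (G,G). Then $\Phi$ is a reduced PEP certificate for $\tilde H^A$ with rate $\tau$ for the performance setup (G,G), (D,G), (G,D), (D,D), respectively (i.e. (D,D)$\mapsto$(G,G), (D,G)$\mapsto$(D,G), (G,D)$\mapsto$(G,D), (G,G)$\mapsto$(D,D)).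
   Context: $N\ge1$ is an integer, $\mathcal I_N=\{0,\dots,N\}$ indexes rows/columns, $\mathbb{1}$ is the all-ones vector. $\mu\in[0,1)$ and $q=\mu/(1-\mu)$. $S\in\mathbb{R}^{\mathcal I_N\times\mathcal I_N}$ has ones on and below the diagonal and zeros elsewhere, $R$ is the reversal permutation matrix, $P=SR$; $\bar S,\bar R,\bar P=\bar S\bar R$ are the $N\times N$ analogues. The antitranspose is $X^A=RX^\intercal R$. For strictly lower triangular $\tilde H$ put $H=(S^{-1}+\tilde H)((1+q)I+qS\tilde H)^{-1}$ and $v_H=(I-qSH)\mathbb{1}$. Elements of $\mathbb{R}^d$ are row vectors. Given $y_0\in\mathbb{R}^d$, $\mathbf g\in\mathbb{R}^{\mathcal I_N\times d}$, let $\mathbf x=-SH\mathbf g+v_Hy_0$, $\mathbf s=\mathbf g+q\mathbf x$, $\mathbf y=\mathbf x+\mathbf s$, with rows $x_i,s_i,y_i$ (row $0$ of $\mathbf y$ is $y_0$). $\mathcal P_{\mathrm{cert}}$ is the set of square real matrices with nonnegative off-diagonal entries, nonpositive row sums and nonpositive column sums. For a setup $(a,b)\in\{\mathrm D,\mathrm G\}^2$, let $p_0=y_0$ if $a=\mathrm D$ and $p_0=s_0$ if $a=\mathrm G$; let $p_N=y_N$ if $b=\mathrm D$ and $p_N=s_N$ if $b=\mathrm G$. A matrix $\Gamma\in\mathbb{R}^{\mathcal I_N\times\mathcal I_N}$ is a PEP certificate of $(a,b)$ convergence of $\tilde H$ with rate $\tau$ if $\Gamma\in\mathcal P_{\mathrm{cert}}$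 and $\frac\tau2\|p_0\|^2-\frac1{2\tau}\|p_N\|^2+\mathrm{tr}(\mathbf g^\intercal\Gamma\mathbf x)\ge0$ for all $(y_0,\mathbf g)$; in the operator setting ($\frac{1-\mu}{1+\mu}$-contractive operators) $\Gamma$ is additionally required to be symmetric, while in the function setting ($1$-smooth $\mu$-strongly convex functions) it is not. Reduced certificates: let $U=\begin{bmatrix}-\mathbb{1}_N^\intercal\\ I_N\end{bmatrix}$, $V=\begin{bmatrix}I_N\\0^\intercal\end{bmatrix}$, $W=\begin{bmatrix}\bar R\\0^\intercal\end{bmatrix}$ (maps $\mathbb{R}^N\to\mathbb{R}^{\mathcal I_N}$). A matrix $\Lambda\in\mathbb{R}^{N\times N}$ is a reduced PEP certificate for (D,D), resp. (G,G), resp. (G,D), convergence if $V\Lambda V^\intercal$, resp. $U\Lambda U^\intercal$, resp. $W\Lambda W^\intercal$, is a PEP certificate for that setup. For (D,G), a reduced PEP certificate is just a PEP certificate $\Lambda\in\mathbb{R}^{\mathcal I_N\times\mathcal I_N}$. *)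

(* Defs.v *)
From HB Require Import structures.
From mathcomp Require Import all_boot all_order all_algebra.
From mathcomp Require Import reals.

Set Implicit Arguments.
Unset Strict Implicit.
Unset Printing Implicit Defensive.

Import Order.TTheory GRing.Theory Num.Theory.
Local Open Scope ring_scope.

(* 'I_N.+1 is the index set {0, ..., N}; the N x N analogues are indexed
   by 'I_N. *)

(* 1-smooth mu-strongly convex functions, or (1-mu)/(1+mu)-contractive
   operators; the setting only affects the symmetry of certificates. *)
Inductive setting := Function_setting | Operator_setting.

(* D: a distance, measured at y.  G: a (sub)gradient, measured at s. *)
Inductive perf_measure := D | G.

Section Matrices.
Variable R : realType.

Definition summx n : 'M[R]_n := \matrix_(i, j) (j <= i)%N%:R.

Definition revmx n : 'M[R]_n := \matrix_(i, j) (j == rev_ord i)%:R.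

Definition Pmx n : 'M[R]_n := summx n *m revmx n.

Definition antitr n (X : 'M[R]_n) : 'M[R]_n := revmx n *m X^T *m revmx n.

Definition ones n : 'cV[R]_n := const_mx 1.

Definition strictly_lower n (X : 'M[R]_n) : Prop :=
  forall i j : 'I_n, (i <= j)%N -> X i j = 0.

Definition tridiagonal n (X : 'M[R]_n) : Prop :=
  forall i j : 'I_n, (i.+1 < j)%N || (j.+1 < i)%N -> X i j = 0.

(* The Euclidean norm squared; the library norm on matrices is the sup norm. *)
Definition sqnorm d (v : 'rV[R]_d) : R := \sum_j v 0 j ^+ 2.

Definition Pcert n (X : 'M[R]_n) : Prop :=
  [/\ forall i j, i != j -> 0 <= X i j,
      forall i, \sum_j X i j <= 0
    & forall j, \sum_i X i j <= 0].

Definition qof (mu : R) : R := mu / (1 - mu).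

End Matrices.

Section Certificates.
Variables (R : realType) (st : setting) (N d : nat) (mu : R).
Variable Ht : 'M[R]_N.+1.

Let q : R := qof mu.
Let S : 'M[R]_N.+1 := summx R N.+1.

Definition Hmx : 'M[R]_N.+1 :=
  (invmx S + Ht) *m invmx ((1 + q)%:M + q *: (S *m Ht)).

Definition vH : 'cV[R]_N.+1 := (1%:M - q *: (S *m Hmx)) *m ones R N.+1.

Section Iterates.
Variables (y0 : 'rV[R]_d) (g : 'M[R]_(N.+1, d)).

Definition xmx : 'M[R]_(N.+1, d) := - (S *m Hmx *m g) + vH *m y0.

Definition smx : 'M[R]_(N.+1, d) := g + q *: xmx.

Definition ymx : 'M[R]_(N.+1, d) := xmx + smx.

Definition p_init (a : perf_measure) : 'rV[R]_d :=
  match a with D => y0 | G => row ord0 smx end.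

Definition p_final (b : perf_measure) : 'rV[R]_d :=
  match b with D => row ord_max ymx | G => row ord_max smx end.

End Iterates.

Definition pep_certificate (a b : perf_measure) (tau : R) (Gamma : 'M[R]_N.+1)
    : Prop :=
  [/\ Pcert Gamma,
      (match st with
       | Function_setting => True
       | Operator_setting => Gamma^T = Gamma
       end)
    & forall (y0 : 'rV[R]_d) (g : 'M[R]_(N.+1, d)),
        0 <= tau / 2 * sqnorm (p_init y0 g a)
             - (2 * tau)^-1 * sqnorm (p_final y0 g b)
             + \tr (g^T *m Gamma *m xmx y0 g)].

Definition Umx : 'M[R]_(N.+1, N) := col_mx (- (ones R N)^T) 1%:M.

Definition Vmx : 'M[R]_(N.+1, N) :=
  castmx (addn1 N, erefl N) (col_mx 1%:M (0 : 'rV[R]_N)).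

Definition Wmx : 'M[R]_(N.+1, N) :=
  castmx (addn1 N, erefl N) (col_mx (revmx R N) (0 : 'rV[R]_N)).

Definition reduced_size (a b : perf_measure) : nat :=
  match a, b with D, G => N.+1 | _, _ => N end.

Definition reduced_pep_certificate (a b : perf_measure) (tau : R)
    : 'M[R]_(reduced_size a b) -> Prop :=
  match a, b return 'M[R]_(reduced_size a b) -> Prop with
  | D, D => fun L => pep_certificate D D tau (Vmx *m L *m Vmx^T)
  | G, G => fun L => pep_certificate G G tau (Umx *m L *m Umx^T)
  | G, D => fun L => pep_certificate G D tau (Wmx *m L *m Wmx^T)
  | D, G => fun L => pep_certificate D G tau L
  end.

End Certificates.

Arguments pep_certificate {R} st {N} d mu Ht a b tau Gamma.
Arguments reduced_pep_certificate {R} st {N} d mu Ht a b tau.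

(* Main.v *)
Require Import Defs.
From mathcomp Require Import all_boot all_order all_algebra.
From mathcomp Require Import reals.
From mathcomp Require Import zify ring lra.

Import Order.TTheory GRing.Theory Num.Theory.
Local Open Scope ring_scope.

(** Two independent facts make the transformed matrix a certificate.

    _Positivity._ Write [D = S^-1] for the first difference matrix.  Then
    [P^-1 = R D = D^T R], so up to a reversal of the indices
    [(P Lambda P)^-1] is [D Lambda^-1 D^T].  The hypotheses say that [- Lambda]
    is an M-matrix, dominant by rows and by columns.  A maximum principle shows
    that its inverse is nonnegative; since a tridiagonal matrix couples an
    interval of indices to its complement only through the end points, the same
    principle makes each column of the inverse monotone on either side of its
    diagonal entry, and so is the difference of two consecutive columns.
    These monotonicities are exactly the sign conditions on [D Lambda^-1 D^T]
    ([Pcert_inv]).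

    _Duality._ Eliminating the resolvent, the iterates are the pairs [(y0, s)],
    arbitrary, with [y = 1 y0 - S Ht s], [x = y - s] and
    [g = (1 + q) s - q y].  In the variables [(p0, pN, g, x)], the latter two
    reduced by the embedding [U], [V], [W] or the identity, the certificate
    inequality says that the nondegenerate form
    [tau / 2 |p0|^2 - (2 tau)^-1 |pN|^2 + <g, Lambda x>]
    is nonnegative on the space of iterates.  This form has as many positive as
    negative squares and the space of iterates has half the total dimension, so
    it is a maximal nonnegative subspace; the inverse form is therefore
    nonpositive on its annihilator ([pep_duality]).  The annihilator consists
    of the iterates of the antitransposed method, in the coordinates
    [P^-1 g'], [P^-1 x'], with [g], [x] and [p0], [pN] exchanged.  All four
    cases of that assertion come from one identity, [iterate_pairing],
    [<s', P^-1 y> - <y', P^-1 s> = <s'_N, y_0> - <y'_0, s_N>],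
    because passing to reduced matrices changes [P^-1] only by a sign and by
    its two corner entries ([Umx_Pinv_Vmx], [Vmx_Pinv_Umx], [Wmx_Pinv_Wmx]);
    the corner terms are what turns [s_N] into [y_N] or [y_0] into [s_0]. *)

Set Implicit Arguments.
Unset Strict Implicit.

(** * Differences, reversal and the inverse of P *)

Section Cone.
Variable R : realType.

Lemma mxBE n m (A B : 'M[R]_(n, m)) i j : (A - B) i j = A i j - B i j.
Proof. by rewrite !mxE. Qed.

Definition difmx n : 'M[R]_n :=
  \matrix_(i, j) ((i == j)%:R - (i == j.+1 :> nat)%:R).

(** At index 0 this is 0 again; every use is guarded by [0 < i]. *)
Definition ord_prev {n} (i : 'I_n) : 'I_n :=
  Ordinal (leq_ltn_trans (leq_pred i) (ltn_ord i)).

Lemma difmxE n m (M : 'M[R]_(n, m)) i j :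
  (difmx n *m M) i j = M i j - (if (0 < i)%N then M (ord_prev i) j else 0).
Proof.
rewrite mxE; under eq_bigr do rewrite mxE mulrBl.
rewrite sumrB (bigD1 i) //= eqxx mul1r big1 ?addr0; last first.
  by move=> k /negPf ki; rewrite eq_sym ki mul0r.
congr (_ - _); case: ifP => i0.
  rewrite (bigD1 (ord_prev i)) //= prednK // eqxx mul1r big1 ?addr0 // => k kp.
  case: eqP => [e|]; last by rewrite mul0r.
  by case/eqP: kp; apply: val_inj; rewrite /= e.
by apply: big1 => k _; case: eqP => [e|]; [rewrite e in i0 | rewrite mul0r].
Qed.

Lemma dif_sum n : difmx n *m summx R n = 1%:M.
Proof.
apply/matrixP => i j; rewrite difmxE !mxE.
case: ifP => [i0|/negbT]; rewrite ?mxE /=.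
  rewrite -(inj_eq val_inj); case: (ltngtP i j) => ij /=.
  - by rewrite leqNgt (leq_ltn_trans (leq_pred i) ij) subr0.
  - by rewrite -ltnS prednK // ij subrr.
  - by rewrite -ij -ltnS prednK // ltnn subr0.
rewrite -eqn0Ngt => /eqP i0; rewrite subr0 -(inj_eq val_inj) /= i0.
by rewrite leqn0 eq_sym.
Qed.

Lemma summx_unit n : summx R n \in unitmx.
Proof. by case: (mulmx1_unit (dif_sum n)). Qed.

Lemma rev_mulE n m (M : 'M[R]_(n, m)) i j : (revmx R n *m M) i j = M (rev_ord i) j.
Proof.
rewrite mxE (bigD1 (rev_ord i)) //= mxE eqxx mul1r big1 ?addr0 // => k kp.
by rewrite mxE (negPf kp) mul0r.
Qed.

Lemma mul_revE n m (M : 'M[R]_(m, n)) i j : (M *m revmx R n) i j = M i (rev_ord j).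
Proof.
rewrite mxE (bigD1 (rev_ord j)) //= mxE rev_ordK eqxx mulr1 big1 ?addr0 // => k kp.
by rewrite mxE -(inj_eq rev_ord_inj) rev_ordK eq_sym (negPf kp) mulr0.
Qed.

Lemma tr_revmx n : (revmx R n)^T = revmx R n.
Proof. by apply/matrixP => i j; rewrite !mxE eq_sym -(inj_eq rev_ord_inj) rev_ordK eq_sym. Qed.

Lemma revmxK n : revmx R n *m revmx R n = 1%:M.
Proof.
by apply/matrixP => i j; rewrite rev_mulE !mxE rev_ordK eq_sym.
Qed.

Definition Pinvmx n := revmx R n *m difmx n.

Lemma Pinvmx_entry n i j :
  Pinvmx n i j = ((i + j).+1 == n)%:R - ((i + j).+2 == n)%:R.
Proof.
rewrite /Pinvmx rev_mulE mxE -(inj_eq val_inj) /=.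
have ii := ltn_ord i.
by congr (_%:R - _%:R); apply/eqP/eqP; lia.
Qed.

Lemma tr_Pinvmx n : (Pinvmx n)^T = Pinvmx n.
Proof. by apply/matrixP => i j; rewrite mxE !Pinvmx_entry addnC. Qed.

Lemma PinvmxE n : Pinvmx n = (difmx n)^T *m revmx R n.
Proof. by rewrite -tr_Pinvmx trmx_mul tr_revmx. Qed.

Lemma mulmx_Pinv n : Pmx R n *m Pinvmx n = 1%:M.
Proof.
rewrite /Pmx /Pinvmx -mulmxA (mulmxA (revmx R n)) revmxK mul1mx.
by rewrite (mulmx1C (dif_sum n)).
Qed.

Lemma inv_PLP n (L : 'M[R]_n) :
  L \in unitmx -> invmx (Pmx R n *m L *m Pmx R n) = Pinvmx n *m invmx L *m Pinvmx n.
Proof.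
have [P PE] : {P | P = Pmx R n} by exists (Pmx R n).
have [Q QE] : {Q | Q = Pinvmx n} by exists (Pinvmx n).
have PQ : P *m Q = 1%:M by rewrite PE QE mulmx_Pinv.
rewrite -PE -QE => uL.
have e : P *m L *m P *m (Q *m invmx L *m Q) = 1%:M.
  by rewrite -!mulmxA (mulmxA P Q) PQ mul1mx (mulmxA L) mulmxV // mul1mx.
have [u _] := mulmx1_unit e.
by rewrite -[LHS]mulmx1 -e mulKmx.
Qed.

(** * Inverses of tridiagonal matrices in the certificate cone *)

(** The generator of a continuous-time Markov chain with killing; a matrix of
    the certificate cone is one together with its transpose. *)
Definition subgenerator n (L : 'M[R]_n) : Prop :=
  (forall i j, i != j -> 0 <= L i j) /\ forall i, \sum_j L i j <= 0.

(** At an index where [u] is minimal and negative, replacing all entries of [u]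
    by that minimum decreases [L u] there to the minimum times a row sum, which
    is nonnegative. *)
Lemma strict_comparison n (L : 'M[R]_n) (u : 'cV_n) :
  subgenerator L -> (forall i, (L *m u) i 0 < 0) -> forall i, 0 <= u i 0.
Proof.
move=> [Loff Lrow] Lu i.
case: (@Order.TotalTheory.arg_minP _ _ _ i xpredT (fun i => u i 0)) => // k _ kmin.
apply: le_trans (kmin i isT); rewrite leNgt; apply/negP => uk.
have := Lu k; rewrite ltNge => /negP; apply.
rewrite mxE; apply: (@le_trans _ _ (\sum_j L k j * u k 0)).
  by rewrite -mulr_suml; apply: mulr_le0 (ltW uk).
apply: ler_sum => j _; have [->//|kj] := eqVneq k j.
by rewrite ler_wpM2l ?Loff ?kmin.
Qed.

(** Invertibility provides [z >= 0] with [L z = -1]; the strict version applied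
    to [u + c z] for small [c > 0] gives the weak one. *)
Lemma comparison_principle n (L : 'M[R]_n) (u : 'cV_n) :
  L \in unitmx -> subgenerator L ->
  (forall i, (L *m u) i 0 <= 0) -> forall i, 0 <= u i 0.
Proof.
move=> uL ML Lu i.
pose z : 'cV[R]_n := - (invmx L *m const_mx 1).
have Lz : L *m z = - const_mx 1 by rewrite mulmxN mulKVmx.
have z0 k : 0 <= z k 0.
  by apply: (strict_comparison ML) => j; rewrite Lz !mxE oppr_lt0 ltr01.
apply/ler_addgt0Pl => e e0.
have [c c0 cz] : exists2 c, 0 < c & c * z i 0 <= e.
  exists (e / (z i 0 + 1)); first by rewrite divr_gt0 // ltr_pwDr.
  rewrite mulrAC ler_pdivrMr ?ltr_pwDr //.
  by rewrite ler_wpM2l ?lerDl // ltW.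
have : 0 <= (u + c *: z) i 0.
  apply: (strict_comparison ML) => j; rewrite mulmxDr -scalemxAr Lz.
  by move: (L *m u) (Lu j) => t tj; rewrite !mxE; lra.
by move: z cz {Lz z0} => z cz; rewrite !mxE; lra.
Qed.

(** Truncating [u] at height [m] on [T] can only decrease [L u]: where nothing
    is cut, only neighbours went down; where the value is cut to [m], every
    relevant neighbour is at most [m], and the row sum is nonpositive.  The comparison
    principle then says that nothing was cut. *)
Lemma barrier_principle n (L : 'M[R]_n) (u : 'cV_n) (T : pred 'I_n) (m : R) :
  L \in unitmx -> subgenerator L -> 0 <= m ->
  (forall k, T k -> 0 <= (L *m u) k 0) ->
  (forall k l, T k -> ~~ T l -> L k l != 0 -> u l 0 <= m) ->
  forall k, T k -> u k 0 <= m.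
Proof.
move=> uL ML m0 Lu bd k Tk.
pose w : 'cV[R]_n := \col_i (if T i then Num.min (u i 0) m else u i 0).
have wu i : w i 0 <= u i 0.
  by rewrite mxE; case: ifP => // _; rewrite ge_min lexx.
suff /(_ k) : forall i, 0 <= (w - u) i 0.
  by rewrite !mxE Tk subr_ge0 le_min lexx.
apply: (comparison_principle uL ML) => i.
have [wi|/eqP wi] := eqVneq (w i 0) (u i 0).
  rewrite mxE; apply: sumr_le0 => j _.
  rewrite mxBE; have [<-|ij] := eqVneq i j.
    by rewrite wi subrr mulr0.
  by rewrite mulr_ge0_le0 ?ML.1 // subr_le0.
have [Ti wim] : T i /\ w i 0 = m.
  move: wi; rewrite mxE; case: ifP => // _.
  by rewrite /Num.min; case: ifP.
rewrite mulmxBr mxBE subr_le0; apply: le_trans (Lu _ Ti).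
rewrite mxE; apply: (@le_trans _ _ (\sum_j L i j * m)).
  apply: ler_sum => j _; have [<-|ij] := eqVneq i j; first by rewrite wim.
  have [->|Lij] := eqVneq (L i j) 0; first by rewrite !mul0r.
  rewrite ler_wpM2l ?ML.1 // mxE; case: ifP => Tj.
    by rewrite ge_min lexx orbT.
  by apply: (bd i) => //; rewrite Tj.
by rewrite -mulr_suml mulr_le0_ge0 ?ML.2.
Qed.

Lemma mulmx_col n m p (A : 'M[R]_(n, m)) (B : 'M[R]_(m, p)) j :
  A *m col j B = col j (A *m B).
Proof. by rewrite !colE mulmxA. Qed.

Lemma inv_le0 n (L : 'M[R]_n) : L \in unitmx -> subgenerator L ->
  forall i j, invmx L i j <= 0.
Proof.
move=> uL ML i j.
suff /(_ i) : forall k, 0 <= (- col j (invmx L)) k 0.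
  by rewrite !mxE oppr_ge0.
apply: (comparison_principle uL ML) => k.
rewrite mulmxN mulmx_col mulmxV // !mxE oppr_le0; exact: ler0n.
Qed.

(** Above the diagonal, the column [- L^-1 e_j] is harmonic on the indices up
    to [k], whose only outside neighbour is [k + 1]; its value there is a
    barrier. *)
Lemma inv_col_antitone n (L : 'M[R]_n) : L \in unitmx -> subgenerator L -> tridiagonal L ->
  forall k k' j : 'I_n, k' = k.+1 :> nat -> (k' <= j)%N ->
  invmx L k' j <= invmx L k j.
Proof.
move=> uL ML TL k k' j kk' k'j.
suff : (- col j (invmx L)) k 0 <= - invmx L k' j by rewrite !mxE lerN2.
apply: (@barrier_principle n L _ (fun l => l <= k)%N) => //.
- by rewrite oppr_ge0 inv_le0.
- move=> l lk; rewrite mulmxN mulmx_col mulmxV // !mxE.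
  by rewrite -(inj_eq val_inj) /= ltn_eqF ?oppr0 //; lia.
- move=> l l' lk; rewrite -ltnNge => kl' Lll'.
  have -> : l' = k'.
    apply: val_inj => /=; case: (ltnP l.+1 l') => [h|h]; last by lia.
    by rewrite TL ?h ?eqxx // in Lll'.
  by rewrite !mxE.
Qed.

Lemma inv_dif_le0 n (L : 'M[R]_n) :
  L \in unitmx -> subgenerator L -> tridiagonal L ->
  forall i j : 'I_n, (i <= j)%N -> (difmx n *m invmx L) i j <= 0.
Proof.
move=> uL ML TL i j ij; rewrite difmxE; case: ifP => i0.
  by rewrite subr_le0 inv_col_antitone //= prednK.
by rewrite subr0 inv_le0.
Qed.

Lemma tridiagonal_tr n (L : 'M[R]_n) : tridiagonal L -> tridiagonal L^T.
Proof. by move=> TL i j h; rewrite mxE TL // orbC. Qed.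

Lemma Pcert_tr n (L : 'M[R]_n) : Pcert L -> Pcert L^T.
Proof.
move=> [o r c]; split=> [i j ij|i|j]; first by rewrite mxE o // eq_sym.
  by under eq_bigr do rewrite mxE.
by under eq_bigr do rewrite mxE.
Qed.

Lemma Pcert_subgenerator n (L : 'M[R]_n) : Pcert L -> subgenerator L.
Proof. by case. Qed.

(** The column [u = L^-1 (e_j - e_(j-1))] satisfies [L u = 0] strictly below row
    [j], and there [u <= 0] by monotonicity along the rows of [L^-1]; hence
    [- u] cannot increase downwards, its value at [i - 1] being a barrier for
    the rows from [i] on. *)
Lemma dif_inv_dif_off n (L : 'M[R]_n) :
  L \in unitmx -> Pcert L -> tridiagonal L ->
  forall i j : 'I_n, (j < i)%N -> 0 <= (difmx n *m invmx L *m (difmx n)^T) i j.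
Proof.
move=> uL PL TL i j ji.
have [ML MT] := (Pcert_subgenerator PL, Pcert_subgenerator (Pcert_tr PL)).
pose Y := invmx L *m (difmx n)^T.
have Yle (k : 'I_n) : (j <= k)%N -> Y k j <= 0.
  move=> jk; have -> : Y k j = Y^T j k by rewrite [RHS]mxE.
  rewrite trmx_mul trmxK trmx_inv.
  by apply: inv_dif_le0 => //; rewrite ?unitmx_tr //; apply: tridiagonal_tr.
rewrite -mulmxA -/Y difmxE (leq_ltn_trans (leq0n j) ji) subr_ge0.
suff : (- col j Y) i 0 <= - Y (ord_prev i) j by rewrite !mxE lerN2.
apply: (@barrier_principle n L _ (fun l => i <= l)%N) => //.
- by rewrite oppr_ge0 Yle //=; lia.
- move=> l il; rewrite mulmxN mulmx_col mulKVmx // !mxE -(inj_eq val_inj) /=.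
  rewrite oppr_ge0 subr_le0 (_ : (j == l :> nat) = false) ?ler0n //.
  by apply/eqP; lia.
- move=> l l' il; rewrite -ltnNge => l'i Lll'.
  have -> : l' = ord_prev i.
    apply: val_inj => /=; case: (ltnP l'.+1 l) => [h|h]; last by lia.
    by rewrite TL ?h ?orbT ?eqxx // in Lll'.
  by rewrite !mxE.
Qed.

Lemma tr_dif_inv_dif n (L : 'M[R]_n) :
  (difmx n *m invmx L *m (difmx n)^T)^T = difmx n *m invmx L^T *m (difmx n)^T.
Proof. by rewrite !trmx_mul trmxK trmx_inv mulmxA. Qed.

(** [D^T 1] is the last basis vector, so the row sums are the differences down
    the last column of [L^-1]. *)
Lemma dif_inv_dif_row n (L : 'M[R]_n) :
  L \in unitmx -> Pcert L -> tridiagonal L ->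
  forall i : 'I_n, \sum_j (difmx n *m invmx L *m (difmx n)^T) i j <= 0.
Proof.
case: n L => [|n] L uL PL TL i; first by case: i.
have e : (difmx n.+1)^T *m const_mx 1 = delta_mx ord_max 0 :> 'cV[R]_n.+1.
  rewrite -[RHS]mul1mx -trmx1 -(mulmx1C (dif_sum n.+1)) trmx_mul -mulmxA; congr mulmx.
  by rewrite -colE; apply/colP => k; rewrite !mxE leq_ord.
have -> : \sum_j (difmx n.+1 *m invmx L *m (difmx n.+1)^T) i j =
          (difmx n.+1 *m invmx L *m (difmx n.+1)^T *m (const_mx 1 : 'cV_n.+1)) i 0.
  by rewrite mxE; apply: eq_bigr => j _; rewrite [const_mx _ _ _]mxE mulr1.
rewrite -mulmxA e -colE mxE.
by apply: inv_dif_le0; rewrite ?leq_ord //; apply: Pcert_subgenerator.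
Qed.

Lemma Pcert_rev n (X : 'M[R]_n) : Pcert X -> Pcert (revmx R n *m X *m revmx R n).
Proof.
have rvE i j : (revmx R n *m X *m revmx R n) i j = X (rev_ord i) (rev_ord j).
  by rewrite mul_revE rev_mulE.
move=> [o r c]; split=> [i j ij|i|j].
- by rewrite rvE o // (inj_eq rev_ord_inj).
- under eq_bigr do rewrite rvE.
  by have := r (rev_ord i); rewrite (reindex_inj rev_ord_inj).
- under eq_bigr do rewrite rvE.
  by have := c (rev_ord j); rewrite (reindex_inj rev_ord_inj).
Qed.

Lemma Pcert_inv n (L : 'M[R]_n) :
  L \in unitmx -> Pcert L -> tridiagonal L -> Pcert (invmx (Pmx R n *m L *m Pmx R n)).
Proof.
move=> uL PL TL; rewrite inv_PLP // {1}/Pinvmx PinvmxE.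
rewrite (_ : _ *m _ = revmx R n *m (difmx n *m invmx L *m (difmx n)^T) *m revmx R n);
  last by rewrite !mulmxA.
apply: Pcert_rev.
have [uT PT TT] : [/\ L^T \in unitmx, Pcert L^T & tridiagonal L^T].
  by split; [rewrite unitmx_tr|apply: Pcert_tr|apply: tridiagonal_tr].
split=> [i j|i|j].
- rewrite neq_ltn => /orP[ij|ji]; last exact: dif_inv_dif_off.
  by have := dif_inv_dif_off uT PT TT ij; rewrite -tr_dif_inv_dif mxE.
- exact: dif_inv_dif_row.
- have := dif_inv_dif_row uT PT TT j; rewrite -tr_dif_inv_dif.
  by under eq_bigr do rewrite mxE.
Qed.

End Cone.

(** * Maximal nonnegative subspaces *)

Section Dual.
Variable R : realType.

Definition dot m d (u v : 'M[R]_(m, d)) : R := \tr (u^T *m v).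

Lemma dotE m d (u v : 'M[R]_(m, d)) : dot u v = \sum_i \sum_j u j i * v j i.
Proof.
by apply: eq_bigr => i _; rewrite mxE; apply: eq_bigr => j _; rewrite mxE.
Qed.

Lemma dotC m d (u v : 'M[R]_(m, d)) : dot u v = dot v u.
Proof. by rewrite /dot -mxtrace_tr trmx_mul trmxK. Qed.

Lemma dotDl m d (u v w : 'M[R]_(m, d)) : dot (u + v) w = dot u w + dot v w.
Proof. by rewrite /dot linearD mulmxDl linearD. Qed.

Lemma dotDr m d (u v w : 'M[R]_(m, d)) : dot w (u + v) = dot w u + dot w v.
Proof. by rewrite /dot mulmxDr linearD. Qed.

Lemma dotZl m d c (u v : 'M[R]_(m, d)) : dot (c *: u) v = c * dot u v.
Proof. by rewrite /dot linearZ -scalemxAl linearZ. Qed.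

Lemma dotZr m d c (u v : 'M[R]_(m, d)) : dot u (c *: v) = c * dot u v.
Proof. by rewrite /dot -scalemxAr linearZ. Qed.

Lemma dotNl m d (u v : 'M[R]_(m, d)) : dot (- u) v = - dot u v.
Proof. by rewrite -scaleN1r dotZl mulN1r. Qed.

Lemma dotNr m d (u v : 'M[R]_(m, d)) : dot u (- v) = - dot u v.
Proof. by rewrite -scaleN1r dotZr mulN1r. Qed.

Definition dot_lin := (dotDl, dotDr, dotZl, dotZr, dotNl, dotNr).

Lemma dot_mull m n d (A : 'M[R]_(m, n)) (u : 'M[R]_(n, d)) v :
  dot (A *m u) v = dot u (A^T *m v).
Proof. by rewrite /dot trmx_mul mulmxA. Qed.

Lemma dot_mulr m n d (A : 'M[R]_(m, n)) (u : 'M[R]_(n, d)) v :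
  dot v (A *m u) = dot (A^T *m v) u.
Proof. by rewrite dotC dot_mull dotC. Qed.

Lemma dot_ge0 m d (u : 'M[R]_(m, d)) : 0 <= dot u u.
Proof.
rewrite dotE; apply: sumr_ge0 => i _; apply: sumr_ge0 => j _.
by rewrite -expr2 sqr_ge0.
Qed.

Lemma dot_eq0 m d (u : 'M[R]_(m, d)) : dot u u = 0 -> u = 0.
Proof.
rewrite dotE => /eqP; rewrite psumr_eq0 => [/allP h|i _]; last first.
  by apply: sumr_ge0 => j _; rewrite -expr2 sqr_ge0.
apply/matrixP => j i; have := h i (mem_index_enum i).
rewrite /= psumr_eq0 => [/allP/(_ j (mem_index_enum j))|k _]; last first.
  by rewrite -expr2 sqr_ge0.
by rewrite mulf_eq0 orbb mxE => /eqP.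
Qed.

Lemma dot_sqnorm d (v : 'rV[R]_d) : sqnorm v = dot v v.
Proof. by rewrite dotE; apply: eq_bigr => i _; rewrite big_ord1 expr2. Qed.

Lemma dot_d0 m (u v : 'M[R]_(m, 0)) : dot u v = 0.
Proof. by rewrite dotE big_ord0. Qed.

Definition qform tau d n (p0 pN : 'rV[R]_d) (w : 'M[R]_(n, d)) (v : 'M[R]_(n, d)) : R :=
  tau / 2 * dot p0 p0 - (2 * tau)^-1 * dot pN pN + dot w v.

(** Injectivity is only tested on matrices with [d.+1] columns, the form in
    which certificates provide it. *)
Lemma inj_unitmx n d (Z : 'M[R]_n) :
  (forall z : 'M[R]_(n, d.+1), Z *m z = 0 -> z = 0) -> Z \in unitmx.
Proof.
move=> Zinj; rewrite -unitmx_tr -row_free_unit -kermx_eq0.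
apply/eqP/trmx_inj; rewrite trmx0.
have ZK : Z *m (kermx Z^T)^T = 0.
  by apply: trmx_inj; rewrite trmx_mul trmxK mulmx_ker trmx0.
apply/matrixP => i j.
have /matrixP/(_ i ord0) : (kermx Z^T)^T *m delta_mx j (ord0 : 'I_d.+1) = 0.
  by apply: Zinj; rewrite mulmxA ZK mul0mx.
rewrite mxE (bigD1 j) //= big1 => [|k /negPf kj]; rewrite !mxE ?kj ?mulr0 //.
by rewrite !eqxx mulr1 addr0 => ->.
Qed.

(** Let [v] be the vector of primal coordinates of the annihilating covector.
    On the subspace [a = 0], [G + L X = 0] the form is negative definite, so no
    nonzero iterate lies in it, and by dimension some iterate [z] agrees with
    [v] modulo this subspace.  As [v] is orthogonal to the iterates,
    [F z + F v = F (z - v) <= 0], whence [F v <= 0]; up to the factor [- 4]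
    this is the conclusion. *)
Lemma pep_duality n d (tau : R) (a b : 'rV[R]_(1 + n)) (G X : 'M[R]_(n, 1 + n))
    (L : 'M[R]_n) :
  0 < tau -> L \in unitmx ->
  (forall z : 'M[R]_(1 + n, d),
     a *m z = 0 -> b *m z = 0 -> G *m z = 0 -> X *m z = 0 -> z = 0) ->
  (forall z : 'M[R]_(1 + n, d),
     0 <= qform tau (a *m z) (b *m z) (G *m z) (L *m (X *m z))) ->
  forall (al be : 'rV[R]_d) (xi eta : 'M[R]_(n, d)),
    (forall z : 'M[R]_(1 + n, d), dot al (a *m z) + dot be (b *m z)
       + dot xi (G *m z) + dot eta (X *m z) = 0) ->
    0 <= qform tau be al (- eta) (invmx L *m xi).
Proof.
move=> t0 uL inj pos al be xi eta ann; rewrite /qform.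
case: d inj pos al be xi eta ann => [|d] inj pos al be xi eta ann.
  by rewrite !dot_d0 !mulr0 subr0 addr0.
have i0 : 0 < (2 * tau)^-1 by rewrite invr_gt0 mulr_gt0.
(* The kernel of Z is the intersection with the negative subspace. *)
pose Z := col_mx a (G + L *m X).
have uZ : Z \in unitmx.
  apply: (@inj_unitmx _ d) => z.
  rewrite /Z mul_col_mx mulmxDl -mulmxA => /eqP.
  rewrite col_mx_eq0 => /andP[/eqP az /eqP/addr0_eq gz].
  have := pos z; rewrite /qform az.
  have -> : G *m z = - (L *m (X *m z)) by rewrite -gz opprK.
  rewrite dotNl {1}/dot mulmx0 mxtrace0 mulr0 add0r => h.
  have b0 := dot_ge0 (b *m z); have x0 := dot_ge0 (L *m (X *m z)).
  have ib := mulr_ge0 (ltW i0) b0.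
  have bz : b *m z = 0.
    apply: dot_eq0; apply/eqP; rewrite -(mulrI_eq0 _ (mulfI (lt0r_neq0 i0))).
    by apply/eqP; lra.
  have LXz : L *m (X *m z) = 0 by apply: dot_eq0; lra.
  have Xz : X *m z = 0 by rewrite -[LHS](mulKmx uL) LXz mulmx0.
  by apply: inj => //; rewrite -[LHS]opprK gz LXz oppr0.
(* In primal coordinates the covector is
   v = (2 / tau al, - 2 tau be, 2 h, 2 L^-1 xi), and z solves Z z = Z v. *)
pose h := invmx L^T *m eta.
pose z := invmx Z *m col_mx ((2 / tau) *: al) (2%:R *: h + 2%:R *: xi).
have : Z *m z = col_mx ((2 / tau) *: al) (2%:R *: h + 2%:R *: xi) by rewrite mulKVmx.
rewrite /Z mul_col_mx mulmxDl -mulmxA => /eq_col_mx[az gz].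
have {gz} gz : G *m z - 2%:R *: h = - (L *m (X *m z) - 2%:R *: xi).
  apply/eqP; rewrite -subr_eq0 opprK addrACA gz -opprD subrr //.
have := congr2 (@dot _ _) gz (erefl (L *m (X *m z) - 2%:R *: xi)).
have := ann z; have := pos z; rewrite /qform az.
have -> : dot eta (X *m z) = dot h (L *m (X *m z)).
  by rewrite (dot_mulr L) /h mulKVmx // unitmx_tr.
have -> : dot (- eta) (invmx L *m xi) = - dot h xi.
  by rewrite dotNl (dot_mulr (invmx L)) trmx_inv.
have := dot_ge0 (L *m (X *m z) - 2%:R *: xi).
have := dot_ge0 (b *m z + (2 * tau) *: be).
move: (L *m (X *m z)) (G *m z) (b *m z) => c g B.
rewrite !dot_lin (dotC B be) (dotC c xi) (dotC g xi) (dotC g c) (dotC h c) (dotC h xi).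
move: (dot B B) (dot be B) (dot be be) (dot al al) => BB bB bb aa.
move: (dot c c) (dot c g) (dot c h) (dot xi c) (dot xi g) (dot xi h) (dot xi xi).
move=> cc cg ch xc xg xh xx H1 H2.
have tn := lt0r_neq0 t0.
have -> : tau / 2 * (2 / tau * (2 / tau * aa)) = 4 * ((2 * tau)^-1 * aa) by field.
have -> : 2 / tau * aa = 4 * ((2 * tau)^-1 * aa) by field.
have : 0 <= (2 * tau)^-1 * BB + 2 * bB + 2 * (tau * bb).
  have -> : (2 * tau)^-1 * BB + 2 * bB + 2 * (tau * bb) = (2 * tau)^-1 *
    (BB + 2 * tau * bB + 2 * tau * (bB + 2 * tau * bb)) by field.
  by rewrite mulr_ge0 // ltW.
move: ((2 * tau)^-1 * BB) ((2 * tau)^-1 * aa) => iBB iaa; lra.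
Qed.
End Dual.

(** * Iterates parametrized by y0 and s *)

Section Iter.
Variables (R : realType) (N : nat) (mu : R).
Hypotheses (mu0 : 0 <= mu) (mu1 : mu < 1).
Notation q := (qof mu).
Notation S := (summx R N.+1).

Lemma qof_ge0 : 0 <= q.
Proof. by rewrite divr_ge0 // subr_ge0 ltW. Qed.

Definition y_of_s (Ht : 'M[R]_N.+1) k (y0 : 'rV[R]_k) (s : 'M[R]_(N.+1, k)) :=
  ones R N.+1 *m y0 - S *m Ht *m s.

Definition resolvent_den (Ht : 'M[R]_N.+1) : 'M_N.+1 := (1 + q)%:M + q *: (S *m Ht).

Lemma resolvent_denE Ht i j :
  resolvent_den Ht i j = (1 + q) *+ (i == j) + q * (S *m Ht) i j.
Proof. by rewrite /resolvent_den; move: (S *m Ht) => K; rewrite !mxE. Qed.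

Lemma sum_lower (Ht : 'M[R]_N.+1) : strictly_lower Ht -> strictly_lower (S *m Ht).
Proof.
move=> lo i j ij; rewrite mxE big1 // => k _; rewrite mxE.
case: (leqP k i) => ki; last by rewrite mul0r.
by rewrite lo ?mulr0 // (leq_trans ki ij).
Qed.

Lemma resolvent_den_unit Ht : strictly_lower Ht -> resolvent_den Ht \in unitmx.
Proof.
move=> lo; have lK := sum_lower lo.
rewrite unitmxE det_trig; last first.
  apply/is_trig_mxP => i j ij.
  by rewrite resolvent_denE -(inj_eq val_inj) ltn_eqF // lK ?mulr0 ?addr0 // ltnW.
rewrite unitfE; apply/prodf_neq0 => i _; rewrite resolvent_denE eqxx lK // mulr0 addr0.
by rewrite gt_eqF // ltr_pwDl ?ltr01 // qof_ge0.
Qed.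

Section Recursion.
Variable Ht : 'M[R]_N.+1.
Hypothesis lo : strictly_lower Ht.
Notation K := (S *m Ht).
Notation M := (resolvent_den Ht).

Lemma xmxP d (y0 : 'rV[R]_d) g :
  M *m xmx mu Ht y0 g = ones R N.+1 *m y0 - (1%:M + K) *m g.
Proof.
have uM := resolvent_den_unit lo.
have SH : S *m Hmx mu Ht = (1%:M + K) *m invmx M.
  by rewrite /Hmx mulmxA mulmxDr mulmxV // summx_unit.
have vE : vH mu Ht = invmx M *m ones R N.+1.
  rewrite /vH SH; congr (_ *m _).
  rewrite -[X in X - _](mulmxV uM) scalemxAl -mulmxBl -[RHS]mul1mx; congr (_ *m _).
  apply/matrixP => i j; rewrite mxBE /resolvent_den; move: K => k.
  by rewrite !mxE; case: eqP => _; rewrite ?mulr1n ?mulr0n; ring.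
have MK : M *m (1%:M + K) = (1%:M + K) *m M.
  rewrite /resolvent_den !mulmxDr !mulmxDl !mulmx1 !mul1mx.
  by rewrite -scalar_mxC -scalemxAl -scalemxAr addrACA.
by rewrite /xmx mulmxDr mulmxN SH vE !mulmxA MK mulmxK // mulmxV // mul1mx addrC.
Qed.

(** The recursion [y = 1 y0 - S Ht s], rewritten with [s = g + q x] and
    [y = x + s], is the linear equation that the resolvent solves. *)
Lemma iterate_eq d (y0 : 'rV[R]_d) g x :
  (y_of_s Ht y0 (g + q *: x) == x + (g + q *: x))
  = (M *m x == ones R N.+1 *m y0 - (1%:M + K) *m g).
Proof.
rewrite /y_of_s /resolvent_den !mulmxDl mulmxDr mul1mx -scalemxAr -scalemxAl mul_scalar_mx.
rewrite scalerDl scale1r -subr_eq0 -[RHS]subr_eq0 -[RHS]oppr_eq0; congr (_ == 0).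
move: (ones _ _ *m y0) (K *m g) (K *m x) => u v w; apply/matrixP => i j.
rewrite !mxE; ring.
Qed.

Lemma ymxE d (y0 : 'rV[R]_d) g : ymx mu Ht y0 g = y_of_s Ht y0 (smx mu Ht y0 g).
Proof. by apply/esym/eqP; rewrite iterate_eq xmxP. Qed.

Lemma xmxE d (y0 : 'rV[R]_d) g : xmx mu Ht y0 g = ymx mu Ht y0 g - smx mu Ht y0 g.
Proof. by rewrite /ymx addrK. Qed.

Lemma gmxE d (y0 : 'rV[R]_d) g :
  g = (1 + q) *: smx mu Ht y0 g - q *: ymx mu Ht y0 g.
Proof.
rewrite /ymx /smx; move: (xmx _ _ _ _) => x.
by apply/matrixP => i j; rewrite !mxE; ring.
Qed.

Lemma smx_of_s d (y0 : 'rV[R]_d) (s : 'M[R]_(N.+1, d)) :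
  let y := y_of_s Ht y0 s in let g := (1 + q) *: s - q *: y in
  smx mu Ht y0 g = s.
Proof.
move=> y g.
have gx : g + q *: (y - s) = s.
  by rewrite /g; move: {g}y => y; apply/matrixP => i j; rewrite !mxE; ring.
have : y_of_s Ht y0 (g + q *: (y - s)) == (y - s) + (g + q *: (y - s)).
  by rewrite gx subrK.
rewrite iterate_eq -xmxP => /eqP /(congr1 (mulmx (invmx M))).
by rewrite !mulKmx ?resolvent_den_unit // /smx => <-.
Qed.

End Recursion.

Definition perf_init a k (y0 : 'rV[R]_k) (s : 'M[R]_(N.+1, k)) : 'rV_k :=
  if a is D then y0 else row ord0 s.
Definition perf_final b k (y s : 'M[R]_(N.+1, k)) : 'rV_k :=
  if b is D then row ord_max y else row ord_max s.

Definition pep_form tau (Ht Ga : 'M[R]_N.+1) a b d (y0 : 'rV[R]_d) s : R :=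
  let y := y_of_s Ht y0 s in
  qform tau (perf_init a y0 s) (perf_final b y s) ((1 + q) *: s - q *: y) (Ga *m (y - s)).

(** [(y0, g) |-> (y0, s)] is a bijection, so the inequality may be tested on
    arbitrary [(y0, s)]. *)
Lemma pep_formP tau (Ht Ga : 'M[R]_N.+1) a b d : strictly_lower Ht ->
  (forall (y0 : 'rV[R]_d) (g : 'M[R]_(N.+1, d)),
        0 <= tau / 2 * sqnorm (p_init mu Ht y0 g a)
             - (2 * tau)^-1 * sqnorm (p_final mu Ht y0 g b)
             + \tr (g^T *m Ga *m xmx mu Ht y0 g)) <->
  (forall (y0 : 'rV[R]_d) s, 0 <= pep_form tau Ht Ga a b y0 s).
Proof.
move=> lo.
have E y0 g : tau / 2 * sqnorm (p_init mu Ht y0 g a)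
             - (2 * tau)^-1 * sqnorm (p_final mu Ht y0 g b)
             + \tr (g^T *m Ga *m xmx mu Ht y0 g) =
          pep_form tau Ht Ga a b y0 (smx mu Ht y0 g) :> R.
  rewrite /pep_form -ymxE // -gmxE -xmxE /qform !dot_sqnorm /dot mulmxA.
  by case: a b => [] [].
split=> h y0 s; last by rewrite E.
by rewrite -(smx_of_s lo y0 s) -E.
Qed.

(** [y0m] and [Sm] parametrize a space of iterates of half dimension by
    [z |-> (y0m z, Sm z)]; it must contain no iterate on which all the
    quantities of the certificate vanish.  The pairing hypothesis says that
    [(- e pN', e p0', - P^-1 T'^T x', P^-1 T'^T g')] annihilates it: the
    cross terms of [g = (1 + q) s - q y] and [x = y - s] cancel to leave the
    stated difference.  The sign [e] is immaterial, since [p0'] and [pN'] enter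
    through their squares. *)
Lemma pep_form_transfer n d tau (T T' : 'M[R]_(N.+1, n)) (L : 'M[R]_n)
    (Ht Ht' : 'M_N.+1) a b a' b' e
   (y0m : 'rV_(1 + n)) (Sm : 'M_(N.+1, 1 + n)) :
  0 < tau -> L \in unitmx -> e ^+ 2 = 1 ->
  (forall z : 'M[R]_(1 + n, d), let y0 := y0m *m z in let s := Sm *m z in
     perf_init a y0 s = 0 -> perf_final b (y_of_s Ht y0 s) s = 0 -> T^T *m s = 0 ->
     T^T *m y_of_s Ht y0 s = 0 -> z = 0) ->
  (forall (y0 y0' : 'rV[R]_d) s s',
     dot (Pinvmx R n *m (T'^T *m s')) (T^T *m y_of_s Ht y0 s)
       - dot (Pinvmx R n *m (T'^T *m y_of_s Ht' y0' s')) (T^T *m s)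
     = e * (dot (perf_final b' (y_of_s Ht' y0' s') s') (perf_init a y0 s)
            - dot (perf_init a' y0' s') (perf_final b (y_of_s Ht y0 s) s))) ->
  (forall (y0 : 'rV[R]_d) s, 0 <= pep_form tau Ht (T *m L *m T^T) a b y0 s) ->
  forall (y0 : 'rV[R]_d) s,
    0 <= pep_form tau Ht' (T' *m invmx (Pmx R n *m L *m Pmx R n) *m T'^T) a' b' y0 s.
Proof.
move=> t0 uL e2 inj pair pos y0' s'; rewrite inv_PLP //.
have yM z : y_of_s Ht (y0m *m z) (Sm *m z) = y_of_s Ht y0m Sm *m z :> 'M_(_, d).
  by rewrite /y_of_s mulmxBl !mulmxA.
have initM z : perf_init a (y0m *m z) (Sm *m z) = perf_init a y0m Sm *m z :> 'rV_d.
  by case: a {inj pair pos} => //=; rewrite row_mul.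
have finM z : perf_final b (y_of_s Ht y0m Sm *m z) (Sm *m z)
    = perf_final b (y_of_s Ht y0m Sm) Sm *m z :> 'rV_d.
  by case: b {inj pair pos} => /=; rewrite row_mul.
set y' := y_of_s Ht' y0' s'; pose g' := (1 + q) *: s' - q *: y'.
pose Y := y_of_s Ht y0m Sm.
have GE (z : 'M[R]_(1 + n, d)) : T^T *m ((1 + q) *: Sm - q *: Y) *m z =
   T^T *m ((1 + q) *: (Sm *m z) - q *: (Y *m z)).
  by rewrite -mulmxA mulmxBl !scalemxAl.
have XE (z : 'M[R]_(1 + n, d)) : T^T *m (Y - Sm) *m z = T^T *m (Y *m z - Sm *m z).
  by rewrite -mulmxA mulmxBl.
have := @pep_duality R n d tau (perf_init a y0m Sm) (perf_final b Y Sm)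
  (T^T *m ((1 + q) *: Sm - q *: Y)) (T^T *m (Y - Sm)) L t0 uL _ _
  (- e *: perf_final b' y' s') (e *: perf_init a' y0' s')
  (- (Pinvmx R n *m (T'^T *m (y' - s')))) (Pinvmx R n *m (T'^T *m g')) _.
have red : qform tau (e *: perf_init a' y0' s') (- e *: perf_final b' y' s')
  (- (Pinvmx R n *m (T'^T *m g'))) (invmx L *m - (Pinvmx R n *m (T'^T *m (y' - s'))))
  = pep_form tau Ht' (T' *m (Pinvmx R n *m invmx L *m Pinvmx R n) *m T'^T) a' b' y0' s'.
  rewrite /pep_form /qform -/y' -/g' mulmxN; move: g' (y' - s') => g x.
  rewrite !(dotZl, dotZr, dotNl, dotNr) opprK.
  have -> t : e * (e * t) = t by rewrite mulrA -expr2 e2 mul1r.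
  have -> t : - e * (- e * t) = t by rewrite mulrA mulrNN -expr2 e2 mul1r.
  by rewrite dot_mull tr_Pinvmx (dot_mull T'^T) trmxK !mulmxA.
rewrite red; apply.
- move=> z az bz gz xz.
  have xz' : T^T *m (Y *m z) = T^T *m (Sm *m z).
    by apply/eqP; rewrite -subr_eq0 -mulmxBr -XE xz.
  have sz : T^T *m (Sm *m z) = 0.
    by move: gz; rewrite GE mulmxBr -!scalemxAr xz' -scalerBl addrK scale1r.
  by apply: inj; rewrite ?yM ?initM ?finM ?xz'.
- move=> z; have := pos (y0m *m z) (Sm *m z).
  rewrite /pep_form yM initM finM -/Y /qform GE XE.
  by move: (_ - _) (Y *m z - _) => g x; rewrite -!mulmxA (dot_mulr T).
- move=> z; have := pair (y0m *m z) y0' (Sm *m z) s'.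
  rewrite yM initM finM -/Y -/y' GE XE /g'.
  move: {g' red}y' {GE XE}Y => y' Y.
  rewrite !mulmxBr -!scalemxAr !dot_lin => /eqP.
  by rewrite -subr_eq0 => /eqP h; rewrite -[RHS]h; ring.
Qed.
End Iter.

(** * The embeddings U, V, W and the inverse of P *)

Section Embeddings.
Variables (R : realType) (N : nat).

Lemma castmx_mull m m' n p (e : m = m') (X : 'M[R]_(m, n)) (A : 'M_(n, p)) :
  castmx (e, erefl n) X *m A = castmx (e, erefl p) (X *m A).
Proof. by case: m' / e; rewrite !castmx_id. Qed.

Lemma mul_VmxE m (A : 'M[R]_(N, m)) :
  Vmx R N *m A = castmx (addn1 N, erefl m) (col_mx A 0).
Proof. by rewrite /Vmx castmx_mull mul_col_mx mul1mx mul0mx. Qed.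

Lemma WmxE : Wmx R N = Vmx R N *m revmx R N.
Proof. by rewrite mul_VmxE. Qed.

Lemma Vmx_lift m (A : 'M[R]_(N, m)) i j : (Vmx R N *m A) (lift ord_max i) j = A i j.
Proof.
rewrite mul_VmxE castmxE cast_ord_id.
have -> : cast_ord (esym (addn1 N)) (lift ord_max i) = lshift 1 i.
  by apply: val_inj; rewrite /= /bump leqNgt ltn_ord.
by rewrite col_mxEu.
Qed.

Lemma Vmx_max m (A : 'M[R]_(N, m)) j : (Vmx R N *m A) ord_max j = 0.
Proof.
rewrite mul_VmxE castmxE cast_ord_id.
have -> : cast_ord (esym (addn1 N)) ord_max = rshift N ord0.
  by apply: val_inj; rewrite /= addn0.
by rewrite col_mxEd mxE.
Qed.

Lemma mul_UmxE m (A : 'M[R]_(N, m)) :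
  Umx R N *m A = col_mx (- ((ones R N)^T *m A)) A.
Proof.
have := mul_col_mx (- (ones R N)^T) 1%:M A.
by rewrite mul1mx mulNmx => <-.
Qed.

Lemma Umx_lift m (A : 'M[R]_(N, m)) i j : (Umx R N *m A) (lift ord0 i) j = A i j.
Proof.
have -> : lift ord0 i = rshift 1 i by apply: val_inj.
by rewrite mul_UmxE (@col_mxEd _ 1).
Qed.

Lemma Umx_ord0 m (A : 'M[R]_(N, m)) j : (Umx R N *m A) ord0 j = - \sum_i A i j.
Proof.
have -> : ord0 = lshift N ord0 :> 'I_(1 + N) by apply: val_inj.
rewrite mul_UmxE (@col_mxEu _ 1) mxE mxE; congr (- _).
by apply: eq_bigr => i _; rewrite !mxE mul1r.
Qed.

Lemma mulmx_tr_entry m n p (A : 'M[R]_(m, n)) (B : 'M_(p, n)) i j :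
  (A *m B^T) i j = (B *m A^T) j i.
Proof. by rewrite -[A *m B^T]trmxK trmx_mul trmxK mxE. Qed.

Lemma tr_Vmx_mul : (Vmx R N)^T *m Vmx R N = 1%:M.
Proof.
rewrite /Vmx trmx_cast /=; case: N.+1 / (addn1 N); rewrite !castmx_id.
by rewrite tr_col_mx mul_row_col trmx1 trmx0 mul0mx addr0 mulmx1.
Qed.

Lemma Pmx_last_row n (j : 'I_n.+1) : Pmx R n.+1 ord_max j = 1.
Proof. by rewrite /Pmx mul_revE mxE leq_ord. Qed.

(** The last row of [P] consists of ones, so the column sums of [P^-1] form the
    last row of [P P^-1]. *)
Lemma Pinvmx_col_sum (j : 'I_N) : \sum_i Pinvmx R N i j = (j.+1 == N)%:R.
Proof.
case: N j => [|n] j; first by case: j.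
have := congr1 (fun M : 'M_n.+1 => M ord_max j) (mulmx_Pinv R n.+1).
rewrite mxE; under eq_bigr do rewrite Pmx_last_row mul1r.
by move=> ->; rewrite mxE eqSS -(inj_eq val_inj) eq_sym.
Qed.

(** [U^T s'] extends by 0 to the omitted index 0, and 0 is the boundary value
    that the N x N differences assume; hence these are the differences of [s']
    except for the last one, which is the corner entry [(0, N)]. *)
Lemma Umx_Pinv_Vmx : Umx R N *m Pinvmx R N *m (Vmx R N)^T
  = Pinvmx R N.+1 - delta_mx ord0 ord_max.
Proof.
apply/matrixP => i k; rewrite mxBE [delta_mx _ _ _ _]mxE Pinvmx_entry -mulmxA.
case: (unliftP ord0 i) => [i'|] ->; last rewrite Umx_ord0.
  rewrite Umx_lift mulmx_tr_entry; case: (unliftP ord_max k) => [k'|] ->.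
    by rewrite Vmx_lift mxE Pinvmx_entry lift_max lift0 /= !addSn !eqSS subr0.
  by rewrite Vmx_max /= subr0 !gtn_eqF ?subrr //= /bump; lia.
under eq_bigr do rewrite mulmx_tr_entry.
case: (unliftP ord_max k) => [k'|] ->.
  under eq_bigr do rewrite Vmx_lift mxE.
  rewrite Pinvmx_col_sum lift_max add0n !eqSS eq_sym [lift _ _ == _]eq_sym.
  by rewrite (negPf (neq_lift _ _)) (ltn_eqF (ltn_ord k')) andbF subr0 sub0r eq_sym.
rewrite big1 => [|l _]; last by rewrite Vmx_max.
by rewrite /= add0n !eqxx /= (gtn_eqF (ltnSn _)) subr0 subrr oppr0.
Qed.

Lemma Vmx_Pinv_Umx : Vmx R N *m Pinvmx R N *m (Umx R N)^T
  = Pinvmx R N.+1 - delta_mx ord_max ord0.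
Proof.
have := congr1 trmx Umx_Pinv_Vmx.
rewrite linearB /= tr_Pinvmx trmx_delta => <-.
by rewrite trmx_mul trmxK (trmx_mul (Umx R N)) tr_Pinvmx mulmxA.
Qed.

(** Reversing both indices of the N x N inverse moves the antidiagonal of [-1]
    entries to the other side of the antidiagonal of ones, which in the larger
    matrix is [- P^-1] without its two corners. *)
Lemma Wmx_Pinv_Wmx : (0 < N)%N -> Wmx R N *m Pinvmx R N *m (Wmx R N)^T
  = - Pinvmx R N.+1 + delta_mx ord0 ord_max + delta_mx ord_max ord0.
Proof.
move=> N0; rewrite WmxE trmx_mul tr_revmx.
have -> : Vmx R N *m revmx R N *m Pinvmx R N *m (revmx R N *m (Vmx R N)^T)
  = Vmx R N *m (revmx R N *m Pinvmx R N *m revmx R N *m (Vmx R N)^T).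
  by rewrite !mulmxA.
have mxDE m n (A B : 'M[R]_(m, n)) i j : (A + B) i j = A i j + B i j by rewrite mxE.
have mxNE m n (A : 'M[R]_(m, n)) i j : (- A) i j = - A i j by rewrite mxE.
apply/matrixP => i k; rewrite !(mxDE, mxNE) ![delta_mx _ _ _ _]mxE Pinvmx_entry.
have lm (j : 'I_N) : (lift ord_max j == ord_max) = false.
  by rewrite eq_sym (negPf (neq_lift _ _)).
case: (unliftP ord_max i) => [i'|] ->.
  rewrite Vmx_lift mulmx_tr_entry lm; case: (unliftP ord_max k) => [k'|] ->.
    rewrite lm andbF !addr0 Vmx_lift mxE mul_revE rev_mulE Pinvmx_entry !lift_max opprB /=.
    have hi := @ltn_ord N i'; have hk := @ltn_ord N k'.
    by congr ((nat_of_bool _)%:R - (nat_of_bool _)%:R); apply/eqP/eqP; lia.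
  have -> : (lift ord_max i' == ord0) = ((lift ord_max i' + N).+1 == N.+1).
    by rewrite -val_eqE /= eqSS; move: (bump _ _) => m; apply/eqP/eqP; lia.
  have -> : ((lift ord_max i' + @ord_max N).+2 == N.+1) = false.
    by move: (lift _ _ : nat) => m; apply/eqP => /=; lia.
  by rewrite Vmx_max eqxx andbT addr0 subr0 addNr.
have -> : (k == ord0) = ((@ord_max N + k).+1 == N.+1).
  by rewrite -val_eqE /= eqSS; apply/eqP/eqP; lia.
have -> : ((@ord_max N + k).+2 == N.+1) = false by apply/eqP => /=; lia.
have -> : (@ord_max N == ord0) = false by rewrite -val_eqE /= gtn_eqF.
by rewrite Vmx_max eqxx subr0 addr0 addNr.
Qed.
End Embeddings.

(** * Pairing the method with its antitranspose *)

Section PairCert.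
Variables (R : realType) (N : nat).

Lemma antitr_lower (Ht : 'M[R]_N.+1) : strictly_lower Ht -> strictly_lower (antitr Ht).
Proof.
move=> lo i j ij; rewrite /antitr mul_revE rev_mulE mxE lo //=.
by rewrite leq_sub2l.
Qed.

Lemma Pinvmx_y_of_s (Ht : 'M[R]_N.+1) d (y0 : 'rV[R]_d) s :
  Pinvmx R N.+1 *m y_of_s Ht y0 s = delta_mx ord_max 0 *m y0 - revmx R N.+1 *m (Ht *m s).
Proof.
rewrite /y_of_s; have -> : ones R N.+1 = summx R N.+1 *m delta_mx ord0 0.
  by rewrite -colE; apply/colP => i; rewrite !mxE.
have QS : Pinvmx R N.+1 *m summx R N.+1 = revmx R N.+1.
  by rewrite -mulmxA dif_sum mulmx1.
rewrite -!(mulmxA (summx _ _)) -mulmxBr (mulmxA (Pinvmx _ _) (summx _ _)) QS.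
rewrite mulmxBr (mulmxA _ (delta_mx _ _)).
suff -> : revmx R N.+1 *m delta_mx ord0 0 = delta_mx ord_max 0 :> 'cV_N.+1 by [].
apply/colP => i; rewrite rev_mulE !mxE -(inj_eq rev_ord_inj) rev_ordK.
by congr ((_ == _) && _)%:R; apply: val_inj; rewrite /= subn1.
Qed.

Lemma dot_delta m d (i : 'I_m) (u : 'M[R]_(m, d)) v :
  dot u (delta_mx i 0 *m v) = dot (row i u) v.
Proof. by rewrite dot_mulr trmx_delta -rowE. Qed.

(** Since [P^-1 y = e_N y0 - R Ht s], pairing with [s'] produces the bilinear
    term [<s', R Ht s>]; the antitransposed method is the one that produces the
    same term with the roles of [s] and [s'] exchanged. *)
Lemma iterate_pairing (Ht : 'M[R]_N.+1) d (y0 y0' : 'rV[R]_d) s s' :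
  dot s' (Pinvmx R N.+1 *m y_of_s Ht y0 s)
    - dot (y_of_s (antitr Ht) y0' s') (Pinvmx R N.+1 *m s)
  = dot (row ord_max s') y0 - dot y0' (row ord_max s).
Proof.
rewrite (dot_mulr (Pinvmx _ _) s) tr_Pinvmx !Pinvmx_y_of_s.
rewrite !dot_lin (dotC _ s) !dot_delta (dotC y0').
have -> : dot (revmx R N.+1 *m (antitr Ht *m s')) s = dot s' (revmx R N.+1 *m (Ht *m s)).
  rewrite /antitr !mulmxA revmxK mul1mx -!mulmxA dot_mull trmxK dot_mull tr_revmx //.
ring.
Qed.

Lemma row0_y_of_s (Ht : 'M[R]_N.+1) d (y0 : 'rV[R]_d) s :
  strictly_lower Ht -> row ord0 (y_of_s Ht y0 s) = y0.
Proof.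
move=> lo; apply/rowP => j; rewrite mxE /y_of_s mxBE -mulmxA.
have -> : (summx R N.+1 *m (Ht *m s)) ord0 j = 0.
  rewrite mulmxA mxE big1 // => k _.
  by rewrite (sum_lower lo) ?mul0r.
by rewrite subr0 mxE big_ord1 mxE mul1r.
Qed.

Lemma dot_deltamx m d (i j : 'I_m) (u v : 'M[R]_(m, d)) :
  dot u (delta_mx i j *m v) = dot (row i u) (row j v).
Proof.
by rewrite -(mul_delta_mx (0 : 'I_1)) -mulmxA dot_delta -rowE.
Qed.

Lemma dot_sandwich n d (T T' : 'M[R]_(N.+1, n)) (Q : 'M_n) (u v : 'M_(N.+1, d)) :
  Q^T = Q -> dot (Q *m (T'^T *m u)) (T^T *m v) = dot u ((T' *m Q *m T^T) *m v).
Proof. by move=> sQ; rewrite dot_mull sQ dot_mull trmxK !mulmxA. Qed.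

(** * Reduced and full certificates in the cone *)

Lemma Pcert_sums n (X : 'M[R]_n) :
  (forall i j, i != j -> 0 <= X i j) ->
  (forall i, (X *m ones R n) i 0 <= 0) -> (forall i, (X^T *m ones R n) i 0 <= 0) -> Pcert X.
Proof.
move=> o r c; split=> // i.
  by move: (r i); rewrite mxE; under eq_bigr do rewrite mxE mulr1.
by move: (c i); rewrite mxE; under eq_bigr do rewrite !mxE mulr1.
Qed.

Lemma Pcert_off n (X : 'M[R]_n) i j : Pcert X -> i != j -> 0 <= X i j.
Proof. by case=> + _ _; apply. Qed.

Lemma Pcert_ones n (X : 'M[R]_n) : Pcert X -> forall i, (X *m ones R n) i 0 <= 0.
Proof. by move=> [_ r _] i; rewrite mxE; under eq_bigr do rewrite mxE mulr1. Qed.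

Lemma Vmx_sandwichE (X : 'M[R]_N) i j :
  (Vmx R N *m X *m (Vmx R N)^T) (lift ord_max i) (lift ord_max j) = X i j.
Proof. by rewrite -mulmxA Vmx_lift mulmx_tr_entry Vmx_lift mxE. Qed.

Lemma tr_sandwich n m (T : 'M[R]_(m, n)) X : (T *m X *m T^T)^T = T *m X^T *m T^T.
Proof. by rewrite !trmx_mul trmxK mulmxA. Qed.

Lemma tr_Vmx_ones : (Vmx R N)^T *m ones R N.+1 = ones R N.
Proof.
have -> : (Vmx R N)^T = (Vmx R N *m 1%:M)^T by rewrite mulmx1.
apply/colP => i; rewrite mxE (bigD1 (lift ord_max i)) //=.
rewrite big1 ?addr0 => [|k].
  by rewrite [(_^T) _ _]mxE Vmx_lift !mxE eqxx mulr1.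
case: (unliftP ord_max k) => [k'|] -> h; last by rewrite [(_^T) _ _]mxE Vmx_max mul0r.
rewrite [(_^T) _ _]mxE Vmx_lift mxE; rewrite (inj_eq lift_inj) in h.
by rewrite (negPf h) mul0r.
Qed.

Lemma Pcert_Vmx (X : 'M[R]_N) : Pcert X -> Pcert (Vmx R N *m X *m (Vmx R N)^T).
Proof.
have rows (Y : 'M[R]_N) : Pcert Y ->
    forall i, (Vmx R N *m Y *m (Vmx R N)^T *m ones R N.+1) i 0 <= 0.
  move=> PY i; rewrite -mulmxA tr_Vmx_ones -mulmxA.
  by case: (unliftP ord_max i) => [i'|] ->; rewrite ?Vmx_max // Vmx_lift Pcert_ones.
move=> PX; apply: Pcert_sums; [|exact: rows|]; last first.
  by rewrite tr_sandwich; apply: rows; apply: Pcert_tr.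
move=> i j; case: (unliftP ord_max i) => [i'|] ->; last by rewrite -mulmxA Vmx_max.
case: (unliftP ord_max j) => [j'|] ->; last by rewrite mulmx_tr_entry Vmx_max.
by rewrite (inj_eq lift_inj) Vmx_sandwichE; exact: Pcert_off.
Qed.

Lemma Vmx_Pcert (X : 'M[R]_N) : Pcert (Vmx R N *m X *m (Vmx R N)^T) -> Pcert X.
Proof.
have rows (Y : 'M[R]_N) : Pcert (Vmx R N *m Y *m (Vmx R N)^T) ->
    forall i, (Y *m ones R N) i 0 <= 0.
  move=> PY i; have := Pcert_ones PY (lift ord_max i).
  by rewrite -mulmxA tr_Vmx_ones -mulmxA Vmx_lift.
move=> PX; apply: Pcert_sums; [|exact: rows|]; last first.
  by apply: rows; rewrite -tr_sandwich; apply: Pcert_tr.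
by move=> i j ij; rewrite -Vmx_sandwichE; apply: (Pcert_off PX); rewrite (inj_eq lift_inj).
Qed.

Lemma tr_Umx_ones : (Umx R N)^T *m ones R N.+1 = 0.
Proof.
have -> : ones R N.+1 = col_mx (1%:M : 'M_1) (ones R N).
  apply/(@colP _ (1 + N)) => i; rewrite !mxE; case: split => k; rewrite !mxE ?ord1 //.
apply: (@etrans _ _ ((col_mx (- (ones R N)^T) 1%:M)^T *m col_mx 1%:M (ones R N))) => //.
by rewrite tr_col_mx mul_row_col linearN /= trmxK trmx1 mulmx1 mul1mx addNr.
Qed.

Lemma Umx_sandwichE (X : 'M[R]_N) i j :
  (Umx R N *m X *m (Umx R N)^T) (lift ord0 i) (lift ord0 j) = X i j.
Proof. by rewrite -mulmxA Umx_lift mulmx_tr_entry Umx_lift mxE. Qed.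

(** The border added by [U] contains minus the row and column sums, so their
    signs become off-diagonal sign conditions. *)
Lemma Umx_sandwich0 (X : 'M[R]_N) i :
  (Umx R N *m X *m (Umx R N)^T) (lift ord0 i) ord0 = - \sum_j X i j.
Proof.
rewrite -mulmxA Umx_lift mulmx_tr_entry Umx_ord0.
by under eq_bigr do rewrite mxE.
Qed.

Lemma Pcert_Umx (X : 'M[R]_N) : Pcert X -> Pcert (Umx R N *m X *m (Umx R N)^T).
Proof.
move=> PX; have PT := Pcert_tr PX.
apply: Pcert_sums => [i j|i|i]; last 2 first.
- by rewrite -mulmxA tr_Umx_ones mulmx0 mxE.
- by rewrite tr_sandwich -mulmxA tr_Umx_ones mulmx0 mxE.
case: (unliftP ord0 i) => [i'|] ->; case: (unliftP ord0 j) => [j'|] -> ij.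
- by rewrite Umx_sandwichE Pcert_off // -(inj_eq (lift_inj (h := ord0))).
- by rewrite Umx_sandwich0 oppr_ge0; case: PX.
- rewrite -[_ *m _]trmxK tr_sandwich mxE Umx_sandwich0 oppr_ge0.
  by case: PT.
- by rewrite eqxx in ij.
Qed.

Lemma Umx_Pcert (X : 'M[R]_N) : Pcert (Umx R N *m X *m (Umx R N)^T) -> Pcert X.
Proof.
have rows (Y : 'M[R]_N) : Pcert (Umx R N *m Y *m (Umx R N)^T) -> forall i, \sum_j Y i j <= 0.
  by move=> PY i; rewrite -oppr_ge0 -Umx_sandwich0; case: PY => + _ _; apply.
move=> PX; split; last 2 first.
- exact: rows.
- move=> j; have /rows/(_ j) : Pcert (Umx R N *m X^T *m (Umx R N)^T).
    by rewrite -tr_sandwich; apply: Pcert_tr.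
  by under eq_bigr do rewrite mxE.
by move=> i j ij; rewrite -Umx_sandwichE; apply: (Pcert_off PX); rewrite (inj_eq lift_inj).
Qed.

Lemma Wmx_sandwich (X : 'M[R]_N) : Wmx R N *m X *m (Wmx R N)^T =
  Vmx R N *m (revmx R N *m X *m revmx R N) *m (Vmx R N)^T.
Proof. by rewrite WmxE trmx_mul tr_revmx !mulmxA. Qed.

Lemma Pcert_Wmx (X : 'M[R]_N) : Pcert X -> Pcert (Wmx R N *m X *m (Wmx R N)^T).
Proof. by move=> PX; rewrite Wmx_sandwich; apply/Pcert_Vmx/Pcert_rev. Qed.

Lemma Wmx_Pcert (X : 'M[R]_N) : Pcert (Wmx R N *m X *m (Wmx R N)^T) -> Pcert X.
Proof.
rewrite Wmx_sandwich => /Vmx_Pcert/Pcert_rev.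
by rewrite !mulmxA revmxK mul1mx -mulmxA revmxK mulmx1.
Qed.

Lemma Wmx_left_inv : (Wmx R N)^T *m Wmx R N = 1%:M.
Proof.
by rewrite WmxE trmx_mul tr_revmx -mulmxA (mulmxA _ (Vmx R N)) tr_Vmx_mul mul1mx revmxK.
Qed.

Lemma Umx_left_inv : (row_mx 0 1%:M : 'M[R]_(N, 1 + N)) *m Umx R N = 1%:M.
Proof. by rewrite [LHS](mul_row_col 0 1%:M) mul0mx add0r mulmx1. Qed.

Lemma sym_inv n (L : 'M[R]_n) : L \in unitmx -> L^T = L ->
  (invmx (Pmx R n *m L *m Pmx R n))^T = invmx (Pmx R n *m L *m Pmx R n).
Proof.
by move=> uL sL; rewrite inv_PLP // trmx_mul (trmx_mul (Pinvmx R n)) tr_Pinvmx trmx_inv sL mulmxA.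
Qed.

Lemma sandwich_sym n m (T : 'M[R]_(m, n)) (A : 'M_(n, m)) (X : 'M_n) :
  A *m T = 1%:M -> (T *m X *m T^T)^T = T *m X *m T^T -> X^T = X.
Proof.
move=> AT; rewrite tr_sandwich => /(congr1 (fun M => A *m M *m A^T)).
by rewrite !mulmxA AT -!mulmxA -!trmx_mul AT trmx1 !mulmx1 !mul1mx.
Qed.
End PairCert.

(** * The four performance setups *)

(** The left inverse [A] of the embedding recovers the symmetry of [L] from that
    of the full certificate. *)
Lemma certificate_transfer (R : realType) (st : setting) N d (mu : R) tau n
   (T T' : 'M[R]_(N.+1, n)) (A : 'M_(n, N.+1)) (L : 'M[R]_n) (Ht : 'M_N.+1) a b a' b' e
   (y0m : 'rV_(1 + n)) (Sm : 'M_(N.+1, 1 + n)) :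
  0 <= mu -> mu < 1 -> strictly_lower Ht -> 0 < tau -> L \in unitmx -> tridiagonal L ->
  A *m T = 1%:M ->
  (Pcert (T *m L *m T^T) -> Pcert L) ->
  (forall X, Pcert X -> Pcert (T' *m X *m T'^T)) ->
  e ^+ 2 = 1 ->
  (forall z : 'M[R]_(1 + n, d), let y0 := y0m *m z in let s := Sm *m z in
     perf_init a y0 s = 0 -> perf_final b (y_of_s Ht y0 s) s = 0 -> T^T *m s = 0 ->
     T^T *m y_of_s Ht y0 s = 0 -> z = 0) ->
  (forall (y0 y0' : 'rV[R]_d) s s',
     dot s' ((T' *m Pinvmx R n *m T^T) *m y_of_s Ht y0 s)
       - dot (y_of_s (antitr Ht) y0' s') ((T' *m Pinvmx R n *m T^T) *m s)
     = e * (dot (perf_final b' (y_of_s (antitr Ht) y0' s') s') (perf_init a y0 s)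
            - dot (perf_init a' y0' s') (perf_final b (y_of_s Ht y0 s) s))) ->
  pep_certificate st d mu Ht a b tau (T *m L *m T^T) ->
  pep_certificate st d mu (antitr Ht) a' b' tau
    (T' *m invmx (Pmx R n *m L *m Pmx R n) *m T'^T).
Proof.
move=> mu0 mu1 lo t0 uL TL AT PT PT' e2 inj pair [PL symL pos]; split.
- by apply: PT'; apply: Pcert_inv => //; apply: PT.
- case: st symL => // symL.
  by rewrite tr_sandwich sym_inv // (sandwich_sym AT symL).
- apply/(pep_formP mu0 mu1 _ _ _ _ _ (antitr_lower lo)).
  apply: (@pep_form_transfer R N mu n d tau T T' L Ht (antitr Ht) a b a' b' e y0m Sm) => //.
    by move=> y0 y0' s s'; rewrite !dot_sandwich ?tr_Pinvmx // pair.
  by apply/(pep_formP mu0 mu1 _ _ _ _ _ lo).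
Qed.

Theorem proposition2 (R : realType) (st : setting) (N d : nat) (hN : (1 <= N)%N)
    (mu : R) (hmu0 : 0 <= mu) (hmu1 : mu < 1)
    (Ht : 'M[R]_N.+1) (hHt : strictly_lower Ht) (tau : R) (htau : 0 < tau) :
  [/\ 0 < qof mu -> forall Lam : 'M[R]_N,
        Lam \in unitmx -> tridiagonal Lam ->
        reduced_pep_certificate st d mu Ht D D tau Lam ->
        reduced_pep_certificate st d mu (antitr Ht) G G tau
          (invmx (Pmx R N *m Lam *m Pmx R N)),
      0 <= qof mu -> forall Lam : 'M[R]_N.+1,
        Lam \in unitmx -> tridiagonal Lam ->
        reduced_pep_certificate st d mu Ht D G tau Lam ->
        reduced_pep_certificate st d mu (antitr Ht) D G tau
          (invmx (Pmx R N.+1 *m Lam *m Pmx R N.+1)),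
      0 < qof mu -> forall Lam : 'M[R]_N,
        Lam \in unitmx -> tridiagonal Lam ->
        reduced_pep_certificate st d mu Ht G D tau Lam ->
        reduced_pep_certificate st d mu (antitr Ht) G D tau
          (invmx (Pmx R N *m Lam *m Pmx R N))
    & 0 < qof mu -> forall Lam : 'M[R]_N,
        Lam \in unitmx -> tridiagonal Lam ->
        reduced_pep_certificate st d mu Ht G G tau Lam ->
        reduced_pep_certificate st d mu (antitr Ht) D D tau
          (invmx (Pmx R N *m Lam *m Pmx R N))].
Proof.
have zE n (z : 'M[R]_(1 + n, d)) : usubmx z = 0 -> dsubmx z = 0 -> z = 0.
  by move=> u0 l0; rewrite -[z]vsubmxK u0 l0 col_mx0.
have firstE n (z : 'M[R]_(1 + n, d)) : row_mx 1%:M 0 *m z = usubmx z.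
  by rewrite -[z in LHS]vsubmxK mul_row_col mul1mx mul0mx addr0.
have restE n m (B : 'M[R]_(m, n)) (z : 'M[R]_(1 + n, d)) : row_mx 0 B *m z = B *m dsubmx z.
  by rewrite -[z in LHS]vsubmxK mul_row_col mul0mx add0r.
have rowy y0 s := row0_y_of_s (d := d) y0 s hHt.
have rowy' y0 s := row0_y_of_s (d := d) y0 s (antitr_lower hHt).
have pr := iterate_pairing Ht (d := d).
split=> _ L uL TL.
(* (D,D): y_N, and the first N rows of g and x, do not depend on s_N, which is
   set to 0. *)
- apply: (certificate_transfer (A := (Vmx R N)^T) (e := 1)
    (y0m := row_mx 1%:M 0) (Sm := row_mx 0 (Vmx R N))) => //.
  + exact: tr_Vmx_mul.
  + exact: Vmx_Pcert.
  + exact: Pcert_Umx.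
  + by rewrite expr1n.
  + move=> z /=; rewrite firstE restE => y00 _ s0 _; apply: zE => //.
    by rewrite -[LHS]mul1mx -tr_Vmx_mul -mulmxA.
  + move=> y0 y0' s s'; rewrite Umx_Pinv_Vmx /= mul1r.
    have := pr y0 y0' s s'.
    rewrite !mulmxBl !dotDr !dotNr !dot_deltamx rowy'.
    by lra.
(* (D,G): there is no reduction. *)
- have sw X : X = 1%:M *m X *m (1%:M : 'M[R]_N.+1)^T by rewrite trmx1 mulmx1 mul1mx.
  rewrite /= => cert; rewrite [invmx _]sw; rewrite [L]sw in cert.
  apply: (certificate_transfer (A := 1%:M) (e := 1)
    (y0m := row_mx 1%:M 0) (Sm := row_mx 0 1%:M)) cert => //.
  + by rewrite mulmx1.
  + by rewrite -sw.
  + by move=> X; rewrite -sw.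
  + by rewrite expr1n.
  + move=> z /=; rewrite firstE restE mul1mx => y00 _ s0 _; apply: zE => //.
    by rewrite -[LHS]mul1mx -trmx1.
  + move=> y0 y0' s s'; rewrite -sw /= mul1r.
    exact: pr.
(* (G,D): again nothing depends on s_N; that y0 is recovered from the reduced y
   uses N >= 1. *)
- apply: (certificate_transfer (A := (Wmx R N)^T) (e := -1)
    (y0m := row_mx 1%:M 0) (Sm := row_mx 0 (Vmx R N))) => //.
  + exact: Wmx_left_inv.
  + exact: Wmx_Pcert.
  + exact: Pcert_Wmx.
  + by rewrite sqrrN expr1n.
  + move=> z /=; rewrite firstE restE => _ _ s0 y0.
    have WV : (Wmx R N)^T *m Vmx R N = revmx R N.
      by rewrite WmxE trmx_mul -mulmxA tr_Vmx_mul mulmx1 tr_revmx.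
    have rest0 : dsubmx z = 0.
      move: s0; rewrite mulmxA WV => /(congr1 (mulmx (revmx R N))).
      by rewrite mulmxA revmxK mul1mx mulmx0.
    apply: zE => //; move: y0; rewrite rest0 /y_of_s !mulmx0 subr0.
    rewrite WmxE trmx_mul tr_revmx -mulmxA (mulmxA _ (ones _ _)) tr_Vmx_ones.
    move=> /(congr1 (mulmx (revmx R N))); rewrite mulmxA revmxK mul1mx mulmx0.
    move=> /matrixP y0; apply/rowP => j; have := y0 (Ordinal hN) j.
    by rewrite mxE big_ord1 [ones _ _ _ _]mxE mul1r [X in _ = X]mxE => ->; rewrite mxE.
  + move=> y0 y0' s s'; rewrite Wmx_Pinv_Wmx //= mulN1r.
    have := pr y0 y0' s s'.
    rewrite !mulmxDl !mulNmx !dotDr !dotNr !dot_deltamx rowy rowy'.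
    by lra.
(* (G,G): y0 translates all rows of y, which U^T does not see, and is set
   to 0. *)
- apply: (certificate_transfer (A := (row_mx 0 1%:M : 'M[R]_(N, 1 + N))) (e := 1)
    (y0m := 0) (Sm := (1%:M : 'M[R]_(1 + N)))) => //.
  + exact: Umx_left_inv.
  + exact: Umx_Pcert.
  + exact: Pcert_Vmx.
  + by rewrite expr1n.
  + move=> z /=; rewrite mul1mx => s0 _ Us _.
    have first0 : usubmx z = 0.
      apply/rowP => j; move/rowP/(_ j): s0; rewrite !mxE => <-.
      by congr (z _ _); apply: val_inj.
    apply: zE => //; rewrite -Us -[z in RHS]vsubmxK first0.
    have := mul_row_col (- (ones R N)^T)^T 1%:M^T (0 : 'rV_d) (dsubmx z).
    by rewrite -tr_col_mx mulmx0 add0r trmx1 mul1mx => e; rewrite -[LHS]e.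
  + move=> y0 y0' s s'; rewrite Vmx_Pinv_Umx /= mul1r.
    have := pr y0 y0' s s'.
    rewrite !mulmxBl !dotDr !dotNr !dot_deltamx rowy.
    by lra.
Qed.
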